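(* Suppose that $f\in\mathcal{F}_{\mu,L}$, i.e. $f:\mathbb{R}^n\to\mathbb{R}$ is $L$-smooth and $\mu$-strongly convex, with minimum value $f_*$. Consider the gradient method $x_{k+1}=x_k-\alpha_k\nabla f(x_k)$ with stepsize $\alpha_k$ determined by exact line search, i.e. $\alpha_k=\arg\min_{\alpha>0} f(x_k-\alpha\nabla f(x_k))$. Then $$f(x_{k+1})-f_*\le\left(\frac{L-\mu}{L+\mu}\right)^2\left(f(x_k)-f_*\right).$$
   Context: Let $\mu,L>0$. A continuously differentiable function $f:\mathbb{R}^n\to\mathbb{R}$ is called $L$-smooth and $\mu$-strongly convex (the class of such functions is denoted $\mathcal{F}_{\mu,L}$) if for all $x,y\in\mathbb{R}^n$: (i) $f(y)\le f(x)+\nabla f(x)^{T}(y-x)+\frac{L}{2}\|x-y\|^2$; (ii) $f(y)\ge f(x)+\nabla f(x)^{T}(y-x)+\frac{\mu}{2}\|x-y\|^2$. Here $\|\cdot\|$ is the Euclidean norm, and $f_*=\min_{x\in\mathbb{R}^n}f(x)$ is the optimal value. The line search is performed at iterates with $\nabla f(x_k)\neq 0$. *)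

(* Defs.v *)
From mathcomp Require Import all_boot all_order all_algebra.
From mathcomp Require Import all_classical all_reals all_analysis.
Set Implicit Arguments.
Unset Strict Implicit.
Unset Printing Implicit Defensive.
Import Order.TTheory GRing.Theory Num.Theory.
Import numFieldNormedType.Exports.
Local Open Scope classical_set_scope.
Local Open Scope ring_scope.

Definition dot (R : realType) (n : nat) (u v : 'cV[R]_n) : R :=
  (u^T *m v) 0 0.

(* The library norm `|x| on matrices is the sup norm, hence this definition.
   Both norms induce the same topology and the same notion of
   differentiability, for which the library structures are used. *)
Definition enorm (R : realType) (n : nat) (u : 'cV[R]_n) : R :=
  Num.sqrt (\sum_i u i 0 ^+ 2).

(* Partial derivatives along the canonical basis. *)
Definition grad (R : realType) (n : nat) (f : 'cV[R]_n -> R) (x : 'cV[R]_n) :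
    'cV[R]_n :=
  \col_i 'D_(delta_mx i 0) f x.

Definition C1 (R : realType) (n : nat) (f : 'cV[R]_n -> R) : Prop :=
  (forall x, differentiable f x) /\ continuous (grad f).

Definition smooth_strongly_convex (R : realType) (n : nat) (mu L : R)
    (f : 'cV[R]_n -> R) : Prop :=
  [/\ C1 f,
      forall x y, f y <= f x + dot (grad f x) (y - x)
                         + L / 2 * enorm (x - y) ^+ 2
    & forall x y, f y >= f x + dot (grad f x) (y - x)
                         + mu / 2 * enorm (x - y) ^+ 2].

Definition is_min_value (T : Type) (R : realType) (f : T -> R) (m : R) : Prop :=
  (exists x, f x = m) /\ (forall x, m <= f x).

Definition is_argmin (T : Type) (R : realType) (A : set T) (g : T -> R)
    (a : T) : Prop :=
  A a /\ (forall b, A b -> g a <= g b).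

Definition exact_line_search (R : realType) (n : nat) (f : 'cV[R]_n -> R)
    (x : 'cV[R]_n) (alpha : R) : Prop :=
  is_argmin [set a : R | 0 < a] (fun a : R => f (x - a *: grad f x)) alpha.

(* Main.v *)
Require Import Defs.
From mathcomp Require Import all_boot all_order all_algebra.
From mathcomp Require Import all_classical all_reals all_analysis.
From mathcomp Require Import ring lra.
Import Order.TTheory GRing.Theory Num.Theory.
Import numFieldNormedType.Exports.
Local Open Scope ring_scope.
Set Implicit Arguments.
Unset Strict Implicit.
Unset Printing Implicit Defensive.

(** Write g(x) for the gradient.  The rate comes from a finite certificate that
    only looks at the three points x0 = x_k, x1 = x_{k+1} and a minimizer xs.

    Convexity of f - (mu/2)|.|^2 together with its (L - mu)-smoothness gives,
    for each ordered pair of points, a sharpened first order lower bound whose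
    remainder [interp_gap] is a quadratic form in the differences of the points
    and of the gradients ([interpolation]).  Exact line search contributes two
    orthogonality relations, g(x1) _|_ g(x0) ([line_search_orthogonal]) and
    hence g(x1) _|_ x1 - x0, and the gradient vanishes at xs ([grad_min_eq0]).
    The bounds for (x1 -> x0), (x0 -> xs) and (x1 -> xs) are added with the
    weights
      (L - mu)/(L + mu),  2 mu (L - mu)/(L + mu)^2,  2 mu/(L + mu).
    The function values then combine to
      ((L - mu)/(L + mu))^2 (f(x0) - fs) - (f(x1) - fs),
    and the other terms combine, up to multiples of the two vanishing inner
    products, to a sum of two squares ([certificate_identity]); so this
    expression is nonnegative.  The certificate is due to de Klerk, Glineur and
    Taylor.

    The remainders carry a factor 1/(L - mu), so mu = L is separate: there the
    step of length 1/L already reaches the minimum ([descent_step] against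
    [gradient_dominated]).  The case mu > L is impossible when the gradient is
    nonzero at some point ([modulus_le]). *)

(** * Bilinearity and positivity of the inner product *)

Lemma dotE (R : realType) (n : nat) (u v : 'cV[R]_n) :
  dot u v = \sum_i u i 0 * v i 0.
Proof. by rewrite /dot mxE; apply: eq_bigr => i _; rewrite mxE. Qed.

Lemma dotC (R : realType) (n : nat) (u v : 'cV[R]_n) : dot u v = dot v u.
Proof. by rewrite !dotE; apply: eq_bigr => i _; rewrite mulrC. Qed.

Lemma dotDl (R : realType) (n : nat) (u v w : 'cV[R]_n) :
  dot (u + v) w = dot u w + dot v w.
Proof. by rewrite /dot linearD mulmxDl mxE. Qed.

Lemma dotDr (R : realType) (n : nat) (u v w : 'cV[R]_n) :
  dot w (u + v) = dot w u + dot w v.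
Proof. by rewrite /dot mulmxDr mxE. Qed.

Lemma dotZl (R : realType) (n : nat) (a : R) (u v : 'cV[R]_n) :
  dot (a *: u) v = a * dot u v.
Proof. by rewrite /dot linearZ -scalemxAl mxE. Qed.

Lemma dotZr (R : realType) (n : nat) (a : R) (u v : 'cV[R]_n) :
  dot u (a *: v) = a * dot u v.
Proof. by rewrite dotC dotZl dotC. Qed.

Lemma dotNl (R : realType) (n : nat) (u v : 'cV[R]_n) : dot (- u) v = - dot u v.
Proof. by rewrite -scaleN1r dotZl mulN1r. Qed.

Lemma dotNr (R : realType) (n : nat) (u v : 'cV[R]_n) : dot u (- v) = - dot u v.
Proof. by rewrite dotC dotNl dotC. Qed.

Definition dot_bilinear (R : realType) (n : nat) :=
  (@dotDl R n, @dotDr R n, @dotNl R n, @dotNr R n, @dotZl R n, @dotZr R n).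

Lemma dot_ge0 (R : realType) (n : nat) (u : 'cV[R]_n) : 0 <= dot u u.
Proof. by rewrite dotE; apply: sumr_ge0 => i _; rewrite -expr2 sqr_ge0. Qed.

Lemma dot_eq0 (R : realType) (n : nat) (u : 'cV[R]_n) :
  (dot u u == 0) = (u == 0).
Proof.
apply/eqP/eqP => [|->]; last by rewrite dotE big1 // => i _; rewrite mxE mul0r.
rewrite dotE => /psumr_eq0P u0; apply/colP => i; rewrite mxE.
by apply/eqP; rewrite -sqrf_eq0 expr2 u0 // => j _; rewrite -expr2 sqr_ge0.
Qed.

Lemma dot_gt0 (R : realType) (n : nat) (u : 'cV[R]_n) :
  u != 0 -> 0 < dot u u.
Proof. by move=> u0; rewrite lt_neqAle eq_sym dot_eq0 u0 dot_ge0. Qed.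

Lemma sqr_enorm (R : realType) (n : nat) (u : 'cV[R]_n) :
  enorm u ^+ 2 = dot u u.
Proof.
rewrite /enorm sqr_sqrtr; last by apply: sumr_ge0 => i _; rewrite sqr_ge0.
by rewrite dotE; apply: eq_bigr => i _; rewrite expr2.
Qed.

(** * Consequences of the two quadratic bounds *)

(** With the displacement p as the variable, the bound at an auxiliary point
    x + p is a polynomial in inner products, ready for bilinear expansion. *)
Lemma quadratic_upper_bound (R : realType) (n : nat) (mu L : R)
    (f : 'cV[R]_n -> R) (x p : 'cV[R]_n) :
  smooth_strongly_convex mu L f ->
  f (x + p) <= f x + dot (grad f x) p + L / 2 * dot p p.
Proof.
case=> _ /(_ x (x + p)) ub _; move: ub.
by rewrite sqr_enorm opprD addNKr (addrC x p) addrK dotNl dotNr opprK.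
Qed.

Lemma quadratic_lower_bound (R : realType) (n : nat) (mu L : R)
    (f : 'cV[R]_n -> R) (x p : 'cV[R]_n) :
  smooth_strongly_convex mu L f ->
  f x + dot (grad f x) p + mu / 2 * dot p p <= f (x + p).
Proof.
case=> _ _ /(_ x (x + p)).
by rewrite sqr_enorm opprD addNKr (addrC x p) addrK dotNl dotNr opprK.
Qed.

Lemma modulus_le (R : realType) (n : nat) (mu L : R) (f : 'cV[R]_n -> R)
    (x : 'cV[R]_n) :
  smooth_strongly_convex mu L f -> grad f x != 0 -> mu <= L.
Proof.
move=> hf /dot_gt0 g_gt0.
have := quadratic_upper_bound x (grad f x) hf.
have := quadratic_lower_bound x (grad f x) hf.
by move=> lb ub; nra.
Qed.

Lemma descent_step (R : realType) (n : nat) (mu L : R) (f : 'cV[R]_n -> R)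
    (x : 'cV[R]_n) :
  0 < L -> smooth_strongly_convex mu L f ->
  f (x - L^-1 *: grad f x) <= f x - dot (grad f x) (grad f x) / (2 * L).
Proof.
move=> L_gt0 hf; apply: le_trans (quadratic_upper_bound _ _ hf) _.
rewrite !dot_bilinear le_eqVlt; apply/orP; left; apply/eqP.
by field; rewrite gt_eqF.
Qed.

(** The right-hand side is minus the minimum over p of the quadratic lower
    bound for f(x + p) - f(x), attained at p = - g(x) / mu. *)
Lemma gradient_dominated (R : realType) (n : nat) (mu L : R)
    (f : 'cV[R]_n -> R) (x y : 'cV[R]_n) :
  0 < mu -> smooth_strongly_convex mu L f ->
  f x - f y <= dot (grad f x) (grad f x) / (2 * mu).
Proof.
move=> mu_gt0 hf.
have := quadratic_lower_bound x (y - x) hf; rewrite subrKC.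
have := dot_ge0 (grad f x + mu *: (y - x)).
move: (y - x) => p; rewrite !dot_bilinear (dotC p) => sq_ge0 lb.
by rewrite ler_pdivlMr; nra.
Qed.

Lemma grad_min_eq0 (R : realType) (n : nat) (mu L : R) (f : 'cV[R]_n -> R)
    (x : 'cV[R]_n) :
  0 < L -> smooth_strongly_convex mu L f -> (forall y, f x <= f y) ->
  grad f x = 0.
Proof.
move=> L_gt0 hf x_min; apply/eqP; rewrite -dot_eq0 eq_le dot_ge0 andbT.
have := le_trans (x_min _) (descent_step x L_gt0 hf).
by rewrite lerBrDl gerDr pmulr_lle0 // invr_gt0 mulr_gt0.
Qed.

(** * Optimality of the line search *)

Lemma linear_coef_eq0 (R : realType) (a c K : R) :
  0 < a -> 0 < K -> (forall t, t < a -> 0 <= t * c + K * t ^+ 2) -> c = 0.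
Proof.
move=> a_gt0 K_gt0 nonneg; apply/eqP; apply: contraT => c_neq0.
have nc_gt0 : 0 < `|c| by rewrite normr_gt0.
(* The step t = - c s makes the linear term negative; this s is small enough
   for both s |c| < a and s K <= 1/2. *)
pose s := a / (2 * a * K + `|c|).
have aK_gt0 : 0 < a * K by rewrite mulr_gt0.
have den_gt0 : 0 < 2 * a * K + `|c| by lra.
have s_gt0 : 0 < s by rewrite divr_gt0.
have sE : s * (2 * a * K + `|c|) = a by rewrite divfK ?gt_eqF.
have saK_gt0 : 0 < s * (a * K) by rewrite mulr_gt0.
have sc_gt0 : 0 < s * `|c| by rewrite mulr_gt0.
have sc_lt : - c * s < a.
  have : - c * s <= s * `|c|.
    by rewrite mulrC ler_pM2l // -normrN ler_norm.
  by lra.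
have sK_le : s * K <= 1 / 2 by rewrite -(ler_pM2l a_gt0); lra.
have := nonneg _ sc_lt.
have -> : - c * s * c + K * (- c * s) ^+ 2 = - (c ^+ 2 * s * (1 - s * K)).
  by ring.
have c2_gt0 : 0 < c ^+ 2 by rewrite exprn_even_gt0.
have : 0 < c ^+ 2 * s * (1 - s * K).
  by rewrite (mulr_gt0 (mulr_gt0 c2_gt0 s_gt0)) //; lra.
by lra.
Qed.

(** The stationarity condition of the line search is extracted from the
    quadratic upper bound at the new point: along the search direction f lies
    below a parabola through its minimum, so that parabola has slope zero
    there. *)
Lemma line_search_orthogonal (R : realType) (n : nat) (mu L : R)
    (f : 'cV[R]_n -> R) (x : 'cV[R]_n) (a : R) :
  0 < L -> smooth_strongly_convex mu L f -> grad f x != 0 ->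
  exact_line_search f x a ->
  dot (grad f (x - a *: grad f x)) (grad f x) = 0.
Proof.
move=> L_gt0 hf /dot_gt0; set g := grad f x => g_gt0 [/= a_gt0 a_min].
apply: (@linear_coef_eq0 _ a _ (L / 2 * dot g g)) => // [|t t_lt].
  by rewrite mulr_gt0 // divr_gt0.
have := a_min (a - t); rewrite /= subr_gt0 => /(_ t_lt).
rewrite scalerBl opprB (addrC (t *: g)) addrA => min_le.
have := le_trans min_le (quadratic_upper_bound (x - a *: g) (t *: g) hf).
rewrite !dot_bilinear => le_parabola.
by lra.
Qed.

(** * Interpolation inequality *)

(** With p = y - x and d = g(y) - g(x), this equals
    mu/2 |p|^2 + |d - mu p|^2 / (2 (L - mu)): the second term is the
    cocoercivity remainder of f - (mu/2)|.|^2. *)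
Definition interp_gap (R : realType) (n : nat) (mu L : R) (p d : 'cV[R]_n) : R :=
  (dot d d + mu * L * dot p p - 2 * mu * dot d p) / (2 * (L - mu)).

(** Evaluate f at the auxiliary point z = y + q: the lower bound at x and the
    upper bound at y both apply to f(z), and this q gives the best comparison,
    because z maximizes the lower bound minus the upper bound. *)
Lemma interpolation (R : realType) (n : nat) (mu L : R) (f : 'cV[R]_n -> R)
    (x y : 'cV[R]_n) :
  mu < L -> smooth_strongly_convex mu L f ->
  f x + dot (grad f x) (y - x)
    + interp_gap mu L (y - x) (grad f y - grad f x) <= f y.
Proof.
move=> mu_lt_L hf.
have Lmu_neq0 : L - mu != 0 by rewrite subr_eq0 gt_eqF.
have yE : y = x + (y - x) by rewrite subrKC.
move: (y - x) yE => p yE.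
pose q := (L - mu)^-1 *: (mu *: p - (grad f y - grad f x)).
have ub := quadratic_upper_bound y q hf.
have lb := quadratic_lower_bound x (p + q) hf.
rewrite addrA -yE in lb.
have := le_trans lb ub.
rewrite /interp_gap -subr_ge0 -[X in _ -> is_true X]subr_ge0.
congr (0 <= _); rewrite /q; move: (grad f x) (grad f y) => g h.
rewrite !dot_bilinear (dotC p g) (dotC p h) (dotC h g).
by field.
Qed.

(** * Sum-of-squares certificate *)

(** Here u = x0 - xs, v = x1 - xs, g = g(x0) and h = g(x1).  The two weights
    of the inner products are the multipliers of the line search conditions
    h _|_ v - u and h _|_ g. *)
Lemma certificate_identity (R : realType) (n : nat) (mu L : R)
    (u v g h : 'cV[R]_n) :
  0 < mu -> mu < L ->
  let s1 := u - ((L + mu) / (L + 3 * mu)) *: v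
    - ((3 * L + mu) / (L * (L + 3 * mu))) *: g
    - ((L + mu) / (L * (L + 3 * mu))) *: h in
  let s2 := v - ((L - mu) ^+ 2 / (2 * mu * L * (L + mu))) *: g
    - ((L + mu) / (2 * mu * L)) *: h in
  (L - mu) / (L + mu) * (dot h (u - v) + interp_gap mu L (u - v) (g - h))
  + 2 * mu * (L - mu) / (L + mu) ^+ 2
    * (dot g (- u) + interp_gap mu L (- u) (- g))
  + 2 * mu / (L + mu) * (dot h (- v) + interp_gap mu L (- v) (- h))
  = mu * L * (L + 3 * mu) / (2 * (L + mu) ^+ 2) * dot s1 s1
    + 2 * L * mu ^+ 2 / ((L - mu) * (L + 3 * mu)) * dot s2 s2
    + dot h (u - v) - 2 / (L + mu) * dot g h.
Proof.
move=> mu_gt0 mu_lt_L s1 s2; rewrite /s1 /s2 /interp_gap !dot_bilinear.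
rewrite (dotC v u) (dotC g u) (dotC h u) (dotC g v) (dotC h v) (dotC h g).
move: (dot u u) (dot u v) (dot u g) (dot u h) (dot v v) (dot v g) (dot v h)
  (dot g g) (dot g h) (dot h h) => uu uv ug uh vv vg vh gg gh hh.
field.
by do ?[apply/andP; split]; rewrite gt_eqF //; lra.
Qed.

Lemma line_search_rate_lt (R : realType) (n : nat) (mu L : R)
    (f : 'cV[R]_n -> R) (xs x0 : 'cV[R]_n) (a : R) :
  0 < mu -> mu < L -> smooth_strongly_convex mu L f ->
  (forall y, f xs <= f y) -> grad f x0 != 0 -> exact_line_search f x0 a ->
  f (x0 - a *: grad f x0) - f xs
    <= ((L - mu) / (L + mu)) ^+ 2 * (f x0 - f xs).
Proof.
move=> mu_gt0 mu_lt_L hf xs_min g0_neq0 ls.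
have L_gt0 : 0 < L by apply: lt_trans mu_lt_L.
have orth := line_search_orthogonal L_gt0 hf g0_neq0 ls.
have gs0 := grad_min_eq0 L_gt0 hf xs_min.
set x1 := x0 - a *: grad f x0 in orth *.
have i10 := interpolation x1 x0 mu_lt_L hf.
have i0s := interpolation x0 xs mu_lt_L hf.
have i1s := interpolation x1 xs mu_lt_L hf.
have orth_step : dot (grad f x1) (x0 - x1) = 0.
  by rewrite opprB subrKC dotZr orth mulr0.
clearbody x1.
have := certificate_identity (x0 - xs) (x1 - xs) (grad f x0) (grad f x1)
  mu_gt0 mu_lt_L.
have stepE : x0 - xs - (x1 - xs) = x0 - x1 by rewrite opprB subrKA.
rewrite /= stepE !opprB orth_step (dotC (grad f x0) (grad f x1)) orth.
rewrite gs0 !sub0r in i0s i1s.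
set s1 := (X in dot X X); set s2 := (X in _ + _ * dot X X + _ - _).
have Lmu_gt0 : 0 < L - mu by rewrite subr_gt0.
have Lpmu_gt0 : 0 < L + mu by rewrite addr_gt0.
have L3mu_gt0 : 0 < L + 3 * mu by lra.
have sos_ge0 : 0 <= mu * L * (L + 3 * mu) / (2 * (L + mu) ^+ 2) * dot s1 s1
    + 2 * L * mu ^+ 2 / ((L - mu) * (L + 3 * mu)) * dot s2 s2.
  by rewrite addr_ge0 // mulr_ge0 ?dot_ge0 // divr_ge0 // ltW // !mulr_gt0 //
    exprn_gt0.
set rho2 := (X in _ <= X * _).
set w1 := (L - mu) / (L + mu).
set w2 := 2 * mu * (L - mu) / (L + mu) ^+ 2.
set w3 := 2 * mu / (L + mu).
have w1_ge0 : 0 <= w1 by rewrite divr_ge0 // ltW.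
have w2_ge0 : 0 <= w2 by rewrite divr_ge0 // ltW // ?mulr_gt0 // exprn_gt0.
have w3_ge0 : 0 <= w3 by rewrite divr_ge0 // ltW // mulr_gt0.
(* The weights make the coefficients of f(x0), f(x1) and fs match. *)
have w2E : w2 = w1 - rho2 by rewrite /w2 /w1 /rho2; field; rewrite gt_eqF.
have w3E : w3 = 1 - w1 by rewrite /w3 /w1; field; rewrite gt_eqF.
move: i10; rewrite orth_step.
move=> /(ler_wpM2l w1_ge0) b10 identity.
move: i0s i1s => /(ler_wpM2l w2_ge0) b0s /(ler_wpM2l w3_ge0) b1s.
rewrite w2E w3E in identity b0s b1s.
by lra.
Qed.

Theorem theorem2 (R : realType) (n : nat) (mu L : R) (hmu : 0 < mu) (hL : 0 < L)
    (f : 'cV[R]_n -> R) (hf : smooth_strongly_convex mu L f)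
    (fstar : R) (hfstar : is_min_value f fstar)
    (x : nat -> 'cV[R]_n) (alpha : nat -> R) (k : nat)
    (hgrad : grad f (x k) != 0)
    (halpha : exact_line_search f (x k) (alpha k))
    (hstep : x k.+1 = x k - alpha k *: grad f (x k)) :
  f (x k.+1) - fstar <= ((L - mu) / (L + mu)) ^+ 2 * (f (x k) - fstar).
Proof.
case: hfstar => -[xs <-] xs_min; rewrite hstep.
have [mu_lt_L|L_le_mu] := ltP mu L; first exact: line_search_rate_lt.
have mu_eq_L : mu = L by apply/le_anti; rewrite (modulus_le hf hgrad).
rewrite -mu_eq_L subrr mul0r expr0n mul0r subr_le0.
(* The step 1/L competes in the line search, and already attains the minimum. *)
have invL_gt0 : 0 < L^-1 by rewrite invr_gt0.
case: halpha => _ /(_ L^-1 invL_gt0) /= /le_trans; apply.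
apply: le_trans (descent_step (x k) hL hf) _.
have := gradient_dominated (x k) xs hmu hf; rewrite mu_eq_L.
by rewrite !lerBlDl addrC.
Qed.
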